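(* Let $f=g\circ F+h$ satisfy Assumption A, and let $M-L_g\|L_p\|>0$. Let $(x_k)_{k\ge 0}$ be generated by the RHOTA algorithm, let $\mu>M+L_g\|L_p\|$, and for every $k\ge 0$ let $$y_{k+1}\in\arg\min_{y\in\mathbb{R}^n} f(y)+\frac{\mu}{(p+1)!}\|y-x_k\|^{p+1}.$$ Assume that, for every $k\ge 0$, $x_{k+1}$ satisfies the inexact optimality condition $$s_M(x_{k+1};x_k)-\min_{y:\ \|y-x_k\|\le D_k}s_M(y;x_k)\le\frac{\delta}{(p+1)!}\|x_{k+1}-x_k\|^{p+1},$$ where $\delta\ge 0$ and $D_k:=\left(\frac{(p+1)!}{\mu}(f(x_k)-f^* )\right)^{\frac1{p+1}}$. Denote $L_\mu=\frac{\mu+\delta+L_g\|L_p\|-M}{\mu-(M+L_g\|L_p\|)}$. Then: 1. $\|y_{k+1}-x_k\|^{p+1}\le L_\mu\|x_{k+1}-x_k\|^{p+1}$ for all $k\ge 0$. 2. For all $k\ge 0$, $$\min_{j=0:k}S_f(y_{j+1})^{\frac{p+1}{p}}\le\frac{L_\mu\,(f(x_0)-f^* )}{k+1}\left(\frac{\mu}{p!}\right)^{\frac{p+1}{p}}\frac{(p+1)!}{M-L_g\|L_p\|}.$$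
   Context: Problem: $\min_{x\in\mathbb{R}^n} f(x):=g(F(x))+h(x)$, where $F=(F_1,\dots,F_m):\mathbb{R}^n\to\mathbb{R}^m$, and $p\ge 1$ is an integer. Assumption A: (1) each $F_i:\mathbb{R}^n\to\mathbb{R}$ is $p$ times differentiable with $p$th derivative Lipschitz continuous with constant $L_p^i$, i.e. $\|D^pF_i(x)-D^pF_i(y)\|\le L_p^i\|x-y\|$ for all $x,y$; (2) $g:\mathbb{R}^m\to\mathbb{R}$ is convex and Lipschitz continuous with constant $L_g$, and $h:\mathbb{R}^n\to\mathbb{R}\cup\{+\infty\}$ is proper, lower semicontinuous and convex; (3) the problem has a solution, and $f^*$ is a real number with $\inf_{x\in\mathrm{dom} f}f(x)\ge f^*$. Notation: $L_p=(L_p^1,\dots,L_p^m)$, $\|\cdot\|$ is the Euclidean norm; $T_p^{F_i}(y;x)=F_i(x)+\sum_{j=1}^p\frac1{j!}D^jF_i(x)[y-x]^j$ is the Taylor approximation of order $p$ at $x$, and $T_p^F=(T_p^{F_1},\dots,T_p^{F_m})$. For $M>0$, $$s_M(y;x):=g\left(T_p^F(y;x)\right)+\frac{M}{(p+1)!}\|y-x\|^{p+1}+h(y).$$ RHOTA algorithm: given $x_0\in\mathrm{dom} f$ and $M>0$, for each $k\ge 0$ take any $x_{k+1}\in\mathrm{dom} f$ with $s_M(x_{k+1};x_k)\le s_M(x_k;x_k)$. $S_f(x):=\mathrm{dist}(0,\partial f(x))$, where $\partial f$ is the limiting (Mordukhovich) subdifferential. *)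

(* Defs.v *)
From HB Require Import structures.
From mathcomp Require Import all_boot all_order all_algebra.
From mathcomp Require Import all_classical all_reals all_analysis.

Set Implicit Arguments.
Unset Strict Implicit.
Unset Printing Implicit Defensive.

Import Order.TTheory GRing.Theory Num.Theory.
Import numFieldNormedType.Exports.

Local Open Scope classical_set_scope.
Local Open Scope ring_scope.

(* The library norm on 'rV[R]_n is the sup norm. The metric quantities below
   use the Euclidean norm [enorm]; the library's topology and Frechet
   differential on 'rV[R]_n do not depend on the choice of norm. *)

Definition dot (R : realType) (n : nat) (u v : 'rV[R]_n) : R :=
  \sum_(i < n) u 0 i * v 0 i.

Definition enorm (R : realType) (n : nat) (u : 'rV[R]_n) : R :=
  Num.sqrt (dot u u).

Definition elipschitz (R : realType) (m : nat) (L : R) (g : 'rV[R]_m -> R) :=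
  forall a b, `|g a - g b| <= L * enorm (a - b).

(* [Dn phi [:: h1; ...; hj] x] is D^j phi(x)[h1, ..., hj], by iterated Frechet
   differentials. Since the space of j-linear forms on R^n is finite
   dimensional, x |-> D^j phi(x) is Frechet differentiable iff each of its
   evaluations x |-> D^j phi(x)[h1, ..., hj] is. *)
Fixpoint Dn (R : realType) (n : nat) (phi : 'rV[R]_n -> R) (hs : seq 'rV[R]_n)
    : 'rV[R]_n -> R :=
  if hs is h :: hs' then fun x => 'd (Dn phi hs') x h else phi.

Definition times_differentiable (R : realType) (n p : nat)
    (phi : 'rV[R]_n -> R) :=
  forall hs : seq 'rV[R]_n, (size hs < p)%N ->
  forall x, differentiable (Dn phi hs) x.

(* Operator norm of a p-linear form, in [\bar R] so that no boundedness has to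
   be known beforehand. *)
Definition mlin_norm (R : realType) (n p : nat)
    (A : p.-tuple 'rV[R]_n -> R) : \bar R :=
  ereal_sup [set `|A hs|%:E | hs in
    [set hs : p.-tuple 'rV[R]_n | forall i, enorm (tnth hs i) <= 1]].

Definition lipschitz_Dn (R : realType) (n p : nat) (L : R)
    (phi : 'rV[R]_n -> R) :=
  forall x y,
    (mlin_norm (fun hs : p.-tuple 'rV[R]_n => Dn phi hs x - Dn phi hs y)%R
       <= (L * enorm (x - y))%:E)%E.

Definition taylor (R : realType) (n p : nat) (phi : 'rV[R]_n -> R)
    (y x : 'rV[R]_n) : R :=
  phi x + \sum_(1 <= j < p.+1) (j`!%:R)^-1 * Dn phi (nseq j (y - x)) x.

Definition coordf (R : realType) (n m : nat) (F : 'rV[R]_n -> 'rV[R]_m)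
    (i : 'I_m) : 'rV[R]_n -> R :=
  fun x => F x 0 i.

Definition taylor_map (R : realType) (n m p : nat)
    (F : 'rV[R]_n -> 'rV[R]_m) (y x : 'rV[R]_n) : 'rV[R]_m :=
  \row_(i < m) taylor p (coordf F i) y x.

Definition dome (R : realType) (n : nat) (f : 'rV[R]_n -> \bar R)
    : set 'rV[R]_n :=
  [set x | (f x < +oo)%E].

Definition proper_fun (R : realType) (n : nat) (h : 'rV[R]_n -> \bar R) :=
  (forall x, h x != -oo%E) /\ dome h !=set0.

(* Products in [\bar R] satisfy 0 * +oo = 0, so t = 0 and t = 1 are harmless. *)
Definition econvex (R : realType) (n : nat) (h : 'rV[R]_n -> \bar R) :=
  forall (x y : 'rV[R]_n) (t : R), 0 <= t <= 1 ->
    (h (t *: x + (1 - t) *: y)%R <= t%:E * h x + (1 - t)%:E * h y)%E.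

Definition minimizer (T : Type) (R : realType) (f : T -> \bar R) (z : T) :=
  forall y, (f z <= f y)%E.

Definition composite (R : realType) (n m : nat) (g : 'rV[R]_m -> R)
    (F : 'rV[R]_n -> 'rV[R]_m) (h : 'rV[R]_n -> \bar R) (x : 'rV[R]_n)
    : \bar R :=
  ((g (F x))%:E + h x)%E.

Definition reg_model (R : realType) (n m p : nat) (g : 'rV[R]_m -> R)
    (F : 'rV[R]_n -> 'rV[R]_m) (h : 'rV[R]_n -> \bar R) (M : R)
    (y x : 'rV[R]_n) : \bar R :=
  ((g (taylor_map p F y x)
    + M / (p.+1)`!%:R * enorm (y - x) ^+ p.+1)%R%:E + h y)%E.

Record assumptionA (R : realType) (n m p : nat) (g : 'rV[R]_m -> R)
    (F : 'rV[R]_n -> 'rV[R]_m) (h : 'rV[R]_n -> \bar R)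
    (Lp : 'rV[R]_m) (Lg fstar : R) : Prop := AssumptionA {
  A_differentiable : forall i, times_differentiable p (coordf F i) ;
  A_lipschitz : forall i, lipschitz_Dn p (Lp 0 i) (coordf F i) ;
  A_g_convex : convex_function [set: 'rV[R]_m] g ;
  A_g_lipschitz : elipschitz Lg g ;
  A_h_proper : proper_fun h ;
  A_h_lsc : lower_semicontinuous h ;
  A_h_convex : econvex h ;
  A_solution : exists xs, minimizer (composite g F h) xs ;
  A_lower_bound : (fstar%:E <=
    ereal_inf [set composite g F h x | x in dome (composite g F h)])%E
}.

Record rhota (R : realType) (n m p : nat) (g : 'rV[R]_m -> R)
    (F : 'rV[R]_n -> 'rV[R]_m) (h : 'rV[R]_n -> \bar R) (M : R)
    (x : nat -> 'rV[R]_n) : Prop := Rhota {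
  rhota_dom : forall k, dome (composite g F h) (x k) ;
  rhota_decr : forall k,
    (reg_model p g F h M (x k.+1) (x k) <= reg_model p g F h M (x k) (x k))%E
}.

Definition frechet_subdiff (R : realType) (n : nat) (f : 'rV[R]_n -> \bar R)
    (x : 'rV[R]_n) : set 'rV[R]_n :=
  [set v | f x \is a fin_num /\
    (0 <= limf_einf (fun y => (f y - f x - (dot v (y - x)%R)%:E)
                              * ((enorm (y - x)%R)^-1)%:E) x^')%E].

Definition limiting_subdiff (R : realType) (n : nat) (f : 'rV[R]_n -> \bar R)
    (x : 'rV[R]_n) : set 'rV[R]_n :=
  [set v | f x \is a fin_num /\
    exists (xs vs : nat -> 'rV[R]_n),
      [/\ xs @ \oo --> x, (fun k => f (xs k)) @ \oo --> f x,
          forall k, frechet_subdiff f (xs k) (vs k) & vs @ \oo --> v]].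

(* Equal to +oo when [A] is empty. *)
Definition dist_set (R : realType) (n : nat) (a : 'rV[R]_n) (A : set 'rV[R]_n)
    : \bar R :=
  ereal_inf [set (enorm (a - v))%:E | v in A].

Definition stationarity (R : realType) (n : nat) (f : 'rV[R]_n -> \bar R)
    (x : 'rV[R]_n) : \bar R :=
  dist_set 0 (limiting_subdiff f x).

(* The radius D_k at x = x_k; [f x] is finite there. *)
Definition model_radius (R : realType) (n p : nat) (f : 'rV[R]_n -> \bar R)
    (fstar mu : R) (x : 'rV[R]_n) : R :=
  ((p.+1)`!%:R / mu * (fine (f x) - fstar)) `^ ((p.+1)%:R^-1).

(* The minimum over the ball is written as an infimum; it is attained, because
   the model is lower semicontinuous in y and the ball is compact. *)
Definition inexact_opt (R : realType) (n m p : nat) (g : 'rV[R]_m -> R)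
    (F : 'rV[R]_n -> 'rV[R]_m) (h : 'rV[R]_n -> \bar R) (M delta D : R)
    (xnext x : 'rV[R]_n) : Prop :=
  (reg_model p g F h M xnext x
     - ereal_inf [set reg_model p g F h M y x |
                   y in [set y | (enorm (y - x) <= D)%R]]
   <= (delta / (p.+1)`!%:R * enorm (xnext - x) ^+ p.+1)%R%:E)%E.

(* Main.v *)
Require Import Defs.
From HB Require Import structures.
From mathcomp Require Import all_boot all_order all_algebra.
From mathcomp Require Import all_classical all_reals all_analysis.
From mathcomp Require Import ring lra.

(** Write K = Lg |Lp|, N = (p+1)!. Taylor's formula along segments gives
    |g (F z) - g (T z)| <= K / N |z - x|^(p+1), so that
    f(z) + (M - K) / N |z - x|^(p+1) <= s_M(z; x) <= f(z) + (M + K) / N |z - x|^(p+1).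
    The proximal point y lies in the ball of radius D_k, and chaining
    s_M(x'; x) <= s_M(y; x) + delta / N |x' - x|^(p+1) with the minimality of y
    yields the first claim. Moreover y being a minimizer makes
    - mu / p! |y - x|^(p-1) (y - x) a Frechet subgradient of f at y, hence
    S_f(y)^((p+1)/p) <= (mu / p!)^((p+1)/p) |y - x|^(p+1), and the descent
    f(x') + (M - K) / N |x' - x|^(p+1) <= f(x) bounds the sum of these terms. *)

Set Implicit Arguments.
Unset Strict Implicit.
Unset Printing Implicit Defensive.

Import Order.TTheory GRing.Theory Num.Theory.
Import numFieldNormedType.Exports.

Local Open Scope classical_set_scope.
Local Open Scope ring_scope.

(** * One-variable Taylor estimate with a Lipschitz top derivative *)

Lemma ge0_ler_of_derive (R : realType) (u v u' v' : R -> R) (t : R) :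
  (forall s : R, is_derive s 1 u (u' s)) ->
  (forall s : R, is_derive s 1 v (v' s)) ->
  (forall s, 0 <= s -> u' s <= v' s) -> u 0 <= v 0 -> 0 <= t -> u t <= v t.
Proof.
move=> du dv le' le0; rewrite le_eqVlt => /predU1P[<- //|t0].
have dw (s : R) : is_derive s 1 (v - u) (v' s - u' s) by exact: is_deriveB.
have [|c] := MVT t0 (fun s _ => dw s).
  apply: continuous_subspaceT => s.
  by apply/differentiable_continuous/derivable1_diffP; have [] := dw s.
rewrite in_itv/= => /andP[c0 _] /eqP; rewrite !fctE subr0 => /eqP E.
have : 0 <= (v' c - u' c) * t by rewrite mulr_ge0 ?subr_ge0 ?le' ?ltW.
by rewrite -E; lra.
Qed.

Lemma is_derive_divided_power (R : realType) (c t : R) (j : nat) :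
  is_derive t 1 (fun s => c * (s ^+ j.+1 / j.+1`!%:R)) (c * (t ^+ j / j`!%:R)).
Proof.
have -> : (fun s => c * (s ^+ j.+1 / j.+1`!%:R)) =
    (c / j.+1`!%:R) *: (id ^+ j.+1 : R -> R).
  by apply/funext => s; rewrite !fctE /GRing.scale/=; ring.
apply: is_derive_eq.
rewrite /GRing.scale /= factS natrM mulr1.
by field; rewrite nat1r !pnatr_eq0 -lt0n fact_gt0.
Qed.

(** Induction on [p], shifting the family [phi] by one index. The remainder of order p+1 has as
    derivative the remainder of order p of the shifted family. Both it and the claimed bound vanish
    at 0, so comparing derivatives integrates the induction hypothesis. The lower bound is the same
    argument with [- C]. *)
Lemma taylor_lipschitz1 (R : realType) (C : R) (p : nat) (phi : nat -> R -> R) :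
  (forall j (t : R), (j < p)%N -> is_derive t 1 (phi j) (phi j.+1 t)) ->
  (forall t, 0 <= t -> `|phi p t - phi p 0| <= C * t) ->
  forall t, 0 <= t ->
  `|phi 0%N t - \sum_(j < p.+1) phi j 0 * (t ^+ j / j`!%:R)|
    <= C * (t ^+ p.+1 / p.+1`!%:R).
Proof.
elim: p phi => [|p IH] phi dphi lip t t0.
  by rewrite big_ord1 fact0 expr0 expr1 !divr1 mulr1; exact: lip.
(* [r j] is the Taylor remainder at 0 of [phi j], with one term fewer each time [j] grows, so that
   [r 1] is the derivative of [r 0]. *)
pose r j (s : R) := phi j s - \sum_(i < p.+2 - j) phi (i + j)%N 0 * (s ^+ i / i`!%:R).
have {IH}r1 s : 0 <= s -> `|r 1%N s| <= C * (s ^+ p.+1 / p.+1`!%:R).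
  move=> s0; have := IH (phi \o S) (fun j t => dphi j.+1 t) lip s s0.
  by rewrite /r subSS subn0; under eq_bigr do rewrite /= -addn1.
have dr (s : R) : is_derive s 1 (r 0%N) (r 1%N s).
  have -> : r 0%N = phi 0%N - (cst (phi 0%N 0) + \sum_(i < p.+1)
      (fun s => phi i.+1 0 * (s ^+ i.+1 / i.+1`!%:R)) : R -> R).
    apply/funext => x; rewrite !fctE /r subn0 big_ord_recl expr0 fact0 divr1 mulr1.
    rewrite fct_sumE; congr (_ - (_ + _)).
    by apply: eq_bigr => i _; rewrite addn0.
  apply: is_deriveB; first exact: dphi.
  rewrite -[X in is_derive _ _ _ X]add0r; apply: is_deriveD.
  rewrite subSS subn0; apply: is_derive_sum => i.
  by rewrite addn1; exact: is_derive_divided_power.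
have dC (c s : R) := is_derive_divided_power c s p.+1.
have r00 : r 0%N 0 = 0.
  rewrite /r subn0 big_ord_recl expr0 fact0 divr1 mulr1 big1 ?addr0 ?subrr// => i _.
  by rewrite expr0n /= mul0r mulr0.
have C0 c : c * (0 ^+ p.+2 / p.+2`!%:R) = 0 :> R by rewrite expr0n /= mul0r mulr0.
have -> : phi 0%N t - \sum_(j < p.+2) phi j 0 * (t ^+ j / j`!%:R) = r 0%N t.
  by rewrite /r subn0; under [in RHS]eq_bigr do rewrite addn0.
rewrite ler_norml -mulNr; apply/andP; split.
- apply: (ge0_ler_of_derive (dC (- C)) dr) => //; last by rewrite r00 C0.
  by move=> s /r1; rewrite ler_norml -mulNr => /andP[].
- apply: (ge0_ler_of_derive dr (dC C)) => //; last by rewrite r00 C0.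
  by move=> s /r1; rewrite ler_norml => /andP[].
Qed.

(** * Euclidean inner product and norm *)

Section euclidean.
Context {R : realType} {n : nat}.
Implicit Types u v w : 'rV[R]_n.

Lemma dotC u v : dot u v = dot v u.
Proof. by apply: eq_bigr => i _; rewrite mulrC. Qed.

Lemma dotDl u v w : dot (u + v) w = dot u w + dot v w.
Proof. by rewrite -big_split; apply: eq_bigr => i _; rewrite mxE mulrDl. Qed.

Lemma dotZl a u v : dot (a *: u) v = a * dot u v.
Proof. by rewrite mulr_sumr; apply: eq_bigr => i _; rewrite mxE mulrA. Qed.

Lemma dotNl u v : dot (- u) v = - dot u v.
Proof. by rewrite -scaleN1r dotZl mulN1r. Qed.

Lemma dotDr u v w : dot u (v + w) = dot u v + dot u w.
Proof. by rewrite !(dotC u) dotDl. Qed.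

Lemma dotZr a u v : dot u (a *: v) = a * dot u v.
Proof. by rewrite !(dotC u) dotZl. Qed.

Lemma dotNr u v : dot u (- v) = - dot u v.
Proof. by rewrite !(dotC u) dotNl. Qed.

Lemma dot_ge0 u : 0 <= dot u u.
Proof. by apply: sumr_ge0 => i _; rewrite -expr2 sqr_ge0. Qed.

Lemma enorm_ge0 u : 0 <= enorm u.
Proof. exact: sqrtr_ge0. Qed.

Lemma sqr_enorm u : enorm u ^+ 2 = dot u u.
Proof. by rewrite sqr_sqrtr ?dot_ge0. Qed.

Lemma enorm_eq0 u : enorm u = 0 -> u = 0.
Proof.
move=> /(congr1 (fun x => x ^+ 2)); rewrite sqr_enorm expr0n => /eqP.
rewrite psumr_eq0 => [/allP u0|i _]; last by rewrite -expr2 sqr_ge0.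
apply/rowP => i; have := u0 i; rewrite mem_index_enum => /(_ isT).
by rewrite mulf_eq0 orbb mxE => /eqP.
Qed.

Lemma enorm0 : enorm (0 : 'rV[R]_n) = 0.
Proof. by rewrite /enorm /dot big1 ?sqrtr0// => i _; rewrite mxE mul0r. Qed.

Lemma enormZ a u : enorm (a *: u) = `|a| * enorm u.
Proof.
by rewrite /enorm dotZl dotZr mulrA -expr2 sqrtrM ?sqr_ge0// sqrtr_sqr.
Qed.

Lemma dot_le_enorm u v : dot u v <= enorm u * enorm v.
Proof.
have [/enorm_eq0->|u0] := eqVneq (enorm u) 0.
  by rewrite enorm0 mul0r -(scale0r v) dotZl mul0r.
have [/enorm_eq0->|v0] := eqVneq (enorm v) 0.
  by rewrite enorm0 mulr0 -(scale0r u) dotZr mul0r.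
have uv0 : 0 < enorm u * enorm v by rewrite mulr_gt0// lt0r ?u0 ?v0 enorm_ge0.
(* This square expands to 2 |u| |v| (|u| |v| - <u, v>), and the positive factor |u| |v| can be
   cancelled. *)
have := dot_ge0 (enorm v *: u - enorm u *: v).
rewrite !(dotDl, dotDr, dotNl, dotNr, dotZl, dotZr) (dotC v u) -!sqr_enorm => H.
by rewrite -subr_ge0 -(pmulr_rge0 _ uv0); nra.
Qed.

Lemma ler_enormD u v : enorm (u + v) <= enorm u + enorm v.
Proof.
rewrite -(@ler_pXn2r _ 2)// ?nnegrE ?addr_ge0 ?enorm_ge0//.
rewrite sqrrD !sqr_enorm !(dotDl, dotDr) (dotC v u).
by have := dot_le_enorm u v; lra.
Qed.

Lemma ler_enorm a u v : 0 <= a -> (forall i, `|u 0 i| <= v 0 i * a) ->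
  enorm u <= enorm v * a.
Proof.
move=> a0 uv; rewrite -(@ler_pXn2r _ 2)// ?nnegrE ?mulr_ge0 ?enorm_ge0//.
rewrite exprMn !sqr_enorm mulr_suml; apply: ler_sum => i _.
rewrite -!expr2 -exprMn -[X in X <= _]real_normK ?num_real// ler_sqr ?nnegrE//.
exact: le_trans (uv i).
Qed.

(** Library balls are balls of the sup norm. The norm of the all-ones vector, the square root of n,
    is the constant comparing it with the Euclidean norm. *)
Lemma ball_enorm u v e : ball u e v ->
  enorm (v - u) <= enorm (const_mx 1 : 'rV[R]_n) * e.
Proof.
move=> [e0 uv]; apply: ler_enorm => [|i]; first exact: ltW.
by rewrite !mxE mul1r distrC ltW//; exact: (uv 0 i).
Qed.

End euclidean.

(* E_q(t) := t^q - s^q - q s^(q-1) (t - s) satisfies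
   E_(q+1) = t E_q + q s^(q-1) (t - s)^2. *)
Lemma expr_tangent_le (R : realType) (s : R) (q : nat) : 0 <= s ->
  exists2 C, 0 <= C & forall t, 0 <= t <= s + 1 ->
    t ^+ q - s ^+ q - q%:R * s ^+ q.-1 * (t - s) <= C * (t - s) ^+ 2.
Proof.
move=> s0; elim: q => [|q [C C0 IH]].
  by exists 0 => // t _; rewrite !expr0 subrr !mul0r subrr.
(* In the recursion for E_q, the factor t in front of E_q is at most s + 1. *)
exists (C * (s + 1) + q%:R * s ^+ q.-1).
  by rewrite addr_ge0 ?mulr_ge0 ?exprn_ge0 ?addr_ge0.
move=> t /andP[t0 ts].
have -> : t ^+ q.+1 - s ^+ q.+1 - q.+1%:R * s ^+ q * (t - s) =
    t * (t ^+ q - s ^+ q - q%:R * s ^+ q.-1 * (t - s)) +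
    q%:R * s ^+ q.-1 * (t - s) ^+ 2.
  by case: q {IH} => [|q] /=; rewrite ?exprS ?expr0 -?natr1; ring.
rewrite mulrDl lerD2r.
apply: (@le_trans _ _ (t * (C * (t - s) ^+ 2))).
  by rewrite ler_wpM2l// IH// t0.
by rewrite mulrA ler_wpM2r ?sqr_ge0// mulrC ler_wpM2l.
Qed.

(** * Error of the Taylor model in several variables *)

Section taylor_map.
Context {R : realType} {n : nat}.
Implicit Types (u x y : 'rV[R]_n) (phi : 'rV[R]_n -> R).

(** One slot at a time: the induction hypothesis at every point pulls the inner factors out of the
    function being differentiated, and the outermost factor comes out by linearity of the
    differential. *)
Lemma Dn_nseqZ p phi (s : R) u x j : times_differentiable p phi -> (j <= p)%N ->
  Dn phi (nseq j (s *: u)) x = s ^+ j * Dn phi (nseq j u) x.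
Proof.
move=> dphi; elim: j x => [|j IH] x jp /=; first by rewrite expr0 mul1r.
have dj : differentiable (Dn phi (nseq j u)) x by apply: dphi; rewrite size_nseq.
have -> : Dn phi (nseq j (s *: u)) = (s ^+ j) *: Dn phi (nseq j u).
  by apply/funext => z; rewrite IH// ltnW.
by rewrite diffZ// linearZ/= exprS -mulrA.
Qed.

Lemma is_derive_along_line phi x u (t : R) : differentiable phi (x + t *: u) ->
  is_derive t 1 (fun s => phi (x + s *: u)) ('d phi (x + t *: u) u).
Proof.
move=> dphi.
have E : (fun e : R => e^-1 *: (((fun s => phi (x + s *: u)) \o shift t) (e *: 1)
      - phi (x + t *: u))) =
    (fun e : R => e^-1 *: ((phi \o shift (x + t *: u)) (e *: u) - phi (x + t *: u))).
  apply/funext => e /=; congr (_ *: (phi _ - _)).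
  by rewrite -[e *: 1]/(e * 1) mulr1 scalerDl addrCA addrA.
split.
  by rewrite /derivable E; exact: diff_derivable.
by rewrite -deriveE// /derive E.
Qed.

Lemma mlin_norm_ge p (A : p.-tuple 'rV[R]_n -> R) (hs : p.-tuple 'rV[R]_n) :
  (forall i, enorm (tnth hs i) <= 1) -> (`|A hs|%:E <= mlin_norm A)%E.
Proof. by move=> h1; apply: ereal_sup_ubound; exists hs. Qed.

Lemma taylor_xx p phi x : times_differentiable p phi -> taylor p phi x x = phi x.
Proof.
move=> dphi; rewrite /taylor big_nat big1 ?addr0// => j /andP[j0 jp].
(* Writing the zero direction as 0 times itself, homogeneity gives a factor 0^j, which vanishes
   since j is at least 1. *)
rewrite subrr -(scale0r (0 : 'rV[R]_n)) (Dn_nseqZ _ _ _ dphi)//.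
by rewrite expr0n gtn_eqF// mul0r mulr0.
Qed.

(** Restrict [phi] to the line through [x] with unit direction [u], and use the one-variable
    estimate at t = |y - x|. Unit length makes (u, ..., u) admissible in the supremum [mlin_norm];
    homogeneity then turns the terms s^j D^j[u]^j into D^j[y - x]^j. The case y = x, where no
    direction exists, is separate. *)
Lemma taylor_lipschitz p phi (L : R) x y :
  times_differentiable p phi -> lipschitz_Dn p L phi ->
  `|phi y - taylor p phi y x| <= L / p.+1`!%:R * enorm (y - x) ^+ p.+1.
Proof.
move=> dphi lip; set s := enorm (y - x).
have s0 : 0 <= s by exact: enorm_ge0.
have [/enorm_eq0 yx|sN0] := eqVneq s 0.
  have -> : s = 0 by rewrite /s yx enorm0.
  by move/subr0_eq: yx ->; rewrite taylor_xx// subrr normr0 expr0n mulr0.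
pose u := s^-1 *: (y - x).
have u1 : enorm u = 1 by rewrite enormZ ger0_norm ?invr_ge0// mulVf.
have su : s *: u = y - x by rewrite scalerA mulfV// scale1r.
have := @taylor_lipschitz1 R L p (fun j t => Dn phi (nseq j u) (x + t *: u)) _ _ s s0.
rewrite /= su [x + (y - x)]addrC subrK scale0r addr0.
rewrite [L * (_ / _)]mulrCA [_ * (L / _)]mulrC.
have -> : \sum_(j < p.+1) Dn phi (nseq j u) x * (s ^+ j / j`!%:R) = taylor p phi y x.
  rewrite -(big_mkord xpredT (fun j => Dn phi (nseq j u) x * (s ^+ j / j`!%:R))).
  rewrite big_nat_recl// expr0 fact0 divr1 mulr1 /taylor/= big_add1 /=.
  congr (_ + _); rewrite !big_nat; apply: eq_bigr => j /andP[_ jp].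
  by have := Dn_nseqZ s u x dphi jp; rewrite su /= => ->; ring.
apply=> [j t jp|t t0].
  by apply: is_derive_along_line; apply: dphi; rewrite size_nseq.
have tE : enorm (x + t *: u - x) = t.
  by rewrite addrC addKr enormZ u1 mulr1 ger0_norm.
have := @mlin_norm_ge p (fun hs => Dn phi hs (x + t *: u) - Dn phi hs x) (nseq_tuple p u).
rewrite -lee_fin => /(_ _)/le_trans -> //; last by rewrite -{2}tE; exact: lip.
by move=> i; rewrite tnth_nseq u1.
Qed.

Lemma lipschitz_taylor_map m p (g : 'rV[R]_m -> R) (F : 'rV[R]_n -> 'rV[R]_m)
    (Lp : 'rV[R]_m) (Lg : R) x y :
  (forall i, times_differentiable p (coordf F i)) ->
  (forall i, lipschitz_Dn p (Lp 0 i) (coordf F i)) -> elipschitz Lg g ->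
  `|g (F y) - g (taylor_map p F y x)|
    <= Lg * enorm Lp / p.+1`!%:R * enorm (y - x) ^+ p.+1.
Proof.
move=> dF lipF lipg; apply: le_trans (lipg _ _) _.
set e := enorm (y - x) ^+ p.+1 / p.+1`!%:R.
have e0 : 0 <= e by rewrite divr_ge0 ?exprn_ge0 ?enorm_ge0.
have -> : Lg * enorm Lp / p.+1`!%:R * enorm (y - x) ^+ p.+1 = Lg * (enorm Lp * e).
  by rewrite /e; ring.
have [Lg0|Lg0] := leP 0 Lg.
  apply/ler_wpM2l => //; apply: ler_enorm => // i; rewrite !mxE /e.
  by rewrite mulrCA mulrC; exact: taylor_lipschitz.
(* A negative Lipschitz constant forces m = 0. *)
have enorm0 (z : 'rV[R]_m) : enorm z = 0.
  have := lipg z 0; rewrite subr0 => /(le_trans (normr_ge0 _)) H.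
  by have := enorm_ge0 z; nra.
by rewrite !enorm0 mul0r.
Qed.

End taylor_map.

(** Only the product has a sign: when m = 0 the constant [L] itself may be negative. *)
Lemma elipschitz_const_ge0 (R : realType) (m : nat) (g : 'rV[R]_m -> R) (L : R)
    (v : 'rV[R]_m) :
  elipschitz L g -> 0 <= L * enorm v.
Proof. by move=> /(_ v 0); rewrite subr0; exact: le_trans. Qed.

(** * Subgradients at a proximal point *)

Lemma enormX_tangent_le (R : realType) (n q : nat) (w : 'rV[R]_n) : (1 <= q)%N ->
  exists2 C, 0 <= C & forall v, enorm v <= enorm w + 1 ->
    enorm v ^+ q.+1 - enorm w ^+ q.+1
      - q.+1%:R * enorm w ^+ q.-1 * dot w (v - w) <= C * enorm (v - w) ^+ 2.
Proof.
move=> q1; have w0 := enorm_ge0 w.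
have [C C0 HC] := expr_tangent_le q.+1 w0.
(* The scalar tangent estimate at |w| gives [C]. It involves |w| (|v| - |w|) where <w, v - w> is
   wanted; the discrepancy |w| |v| - <w, v> is at most |v - w|^2, whence the second summand. *)
exists (C + q.+1%:R * enorm w ^+ q.-1) => [|v vw].
  by rewrite addr_ge0 ?mulr_ge0 ?exprn_ge0.
have v0 := enorm_ge0 v.
have := HC _ (introT andP (conj v0 vw)) => /=.
have wv := dot_le_enorm w v.
have E : enorm (v - w) ^+ 2 = enorm v ^+ 2 + enorm w ^+ 2 - 2 * dot w v.
  by rewrite !sqr_enorm !(dotDl, dotDr, dotNl, dotNr) (dotC v w); ring.
have -> : dot w (v - w) = dot w v - enorm w ^+ 2.
  by rewrite dotDr dotNr sqr_enorm.
case: q q1 {HC} => // q _ /= HC.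
have k0 : 0 <= q.+2%:R * enorm w ^+ q by rewrite mulr_ge0// exprn_ge0.
(* Cauchy-Schwarz, after expanding |v - w|^2. *)
have h1 : (enorm v - enorm w) ^+ 2 <= enorm (v - w) ^+ 2 by rewrite E; nra.
have h2 : enorm w * enorm v - dot w v <= enorm (v - w) ^+ 2.
  by have := sqr_ge0 (enorm v - enorm w); rewrite E; nra.
rewrite [X in _ <= X]mulrDl; apply: (le_trans _ (lerD (ler_wpM2l C0 h1) (ler_wpM2l k0 h2))).
apply: (le_trans _ (lerD HC (lexx _))).
by rewrite !exprS; lra.
Qed.

(** Dividing the local minorant by |z - y| bounds the difference quotient below by - C |z - y|,
    which tends to 0. *)
Lemma frechet_subdiff_quadratic (R : realType) (n : nat) (f : 'rV[R]_n -> \bar R)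
    (y v : 'rV[R]_n) (C r : R) : f y \is a fin_num -> 0 < r -> 0 <= C ->
  (forall z, enorm (z - y) <= r ->
    (f y + (dot v (z - y) - C * enorm (z - y) ^+ 2)%:E <= f z)%E) ->
  frechet_subdiff f y v.
Proof.
move=> fy r0 C0 H; split => //.
rewrite /limf_einf oppe_ge0 /limf_esup; apply/lee_addgt0Pr => e e0; rewrite add0e.
set k := enorm (const_mx 1 : 'rV[R]_n).
have k0 : 0 <= k by exact: enorm_ge0.
(* Points of the sup-norm ball of radius [d] satisfy |z - y| <= (k + 1) d. The first entry makes
   this at most [r], the second makes C |z - y| at most [e]. Adding 1 to [k] and to [C] keeps the
   denominators positive. *)
pose d := Num.min (r / (k + 1)) (e / ((C + 1) * (k + 1))).
have d0 : 0 < d by rewrite lt_min !divr_gt0 ?mulr_gt0// ltr_wpDl.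
apply: ge_ereal_inf; exists (ereal_sup [set (- ((f z - f y - (dot v (z - y))%:E)
    * ((enorm (z - y))^-1)%:E))%E | z in ball y d `\ y]).
  by exists (ball y d `\ y) => //; exact: dnbhs_ball.
apply: ge_ereal_sup => _ [z [yz zy] <-].
have zk : enorm (z - y) <= (k + 1) * d.
  by apply: le_trans (ball_enorm yz) _; rewrite ler_wpM2r ?(ltW d0)// lerDl.
have zr : enorm (z - y) <= r.
  apply: le_trans zk _; rewrite mulrC -ler_pdivlMr ?ltr_wpDl//.
  by rewrite ge_min lexx.
have ze : C * enorm (z - y) <= e.
  apply: (@le_trans _ _ ((C + 1) * ((k + 1) * d))).
    by rewrite ler_pM ?enorm_ge0// lerDl.
  rewrite mulrA mulrC -ler_pdivlMr ?mulr_gt0 ?ltr_wpDl//.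
  by rewrite ge_min lexx orbT.
have z0 : 0 < enorm (z - y).
  rewrite lt_neqAle enorm_ge0 andbT eq_sym; apply/eqP => /enorm_eq0/subr0_eq.
  by apply/eqP/eqP => zy'; apply: zy.
rewrite leeNl; have := H z zr.
case: (f y) fy => // a _; case: (f z) => [b| |] //=; last first.
  by move=> _; rewrite gt0_mulye ?leey// lte_fin invr_gt0.
rewrite -!EFinB -!EFinM -EFinD !lee_fin => ab.
rewrite ler_pdivlMr//; nra.
Qed.

Lemma stationarity_proximal (R : realType) (n p : nat) (f : 'rV[R]_n -> \bar R)
    (c : R) (x y : 'rV[R]_n) :
  (1 <= p)%N -> 0 <= c -> f y \is a fin_num ->
  minimizer (fun z => (f z + (c / p.+1`!%:R * enorm (z - x) ^+ p.+1)%R%:E)%E) y ->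
  (stationarity f y <= (c / p`!%:R * enorm (y - x) ^+ p)%:E)%E.
Proof.
move=> p1 c0 fy miny; set w := y - x.
have [C C0 HC] := enormX_tangent_le w p1.
have cN : 0 <= c / p.+1`!%:R by rewrite divr_ge0.
have ppred : enorm w ^+ p = enorm w ^+ p.-1 * enorm w by rewrite -exprSr prednK.
(* The opposite of the gradient at [y] of the regularizer c / (p+1)! |z - x|^(p+1); its norm is
   exactly the claimed bound. *)
pose v := - (c / p`!%:R * enorm w ^+ p.-1) *: w.
have cv : 0 <= c / p`!%:R * enorm w ^+ p.-1.
  by rewrite mulr_ge0 ?divr_ge0 ?exprn_ge0 ?enorm_ge0.
apply: ge_ereal_inf; exists (enorm (0 - v))%:E; last first.
  by rewrite sub0r /v scaleNr opprK enormZ ger0_norm// ppred mulrA.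
(* Constant sequences show that a Frechet subgradient is a limiting one. *)
exists v => //; split => //; exists (cst y), (cst v).
split; [exact: cvg_cst|rewrite /=; exact: cvg_cst| |exact: cvg_cst] => _ /=.
apply: (@frechet_subdiff_quadratic _ _ _ _ _ (c / p.+1`!%:R * C) 1) => //.
  by rewrite mulr_ge0.
move=> z zy1.
have zxE : z - x = w + (z - y) by rewrite /w [RHS]addrC addrA subrK.
have := miny z.
have := HC (z - x); have -> : z - x - w = z - y by rewrite /w opprB addrA subrK.
rewrite {1}zxE.
have /[swap]/[apply] : enorm (w + (z - y)) <= enorm w + 1.
  by apply: le_trans (ler_enormD _ _) _; rewrite lerD2l.
move: (f y) fy => [a _| |]//; case: (f z) => [b| |]//= HCz; last by move=> _; exact: leey.
rewrite -!EFinD !lee_fin dotZl -/w => ab.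
have cE : c / p`!%:R = c / p.+1`!%:R * p.+1%:R.
  by rewrite factS natrM; field; rewrite nat1r !pnatr_eq0 -lt0n fact_gt0.
rewrite cE; have := ler_wpM2l cN HCz; lra.
Qed.

Lemma exists_le_mean (R : realType) (k : nat) (a : nat -> R) (B : R) :
  \sum_(j < k.+1) a j <= B -> exists j : 'I_k.+1, a j <= B / k.+1%:R.
Proof.
move=> aB; apply: contrapT => /forallNP H.
suff : B < \sum_(j < k.+1) a j by rewrite ltNge aB.
have {1}-> : B = \sum_(j < k.+1) B / k.+1%:R.
  by rewrite sumr_const card_ord -(mulr_natr (B / _)) divfK ?pnatr_eq0.
apply: ltr_sum => [|j _]; last by rewrite ltNge; exact/negP.
by apply/hasP; exists ord0; rewrite ?mem_index_enum.
Qed.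

(** * One step of the algorithm *)

Section rhota_step.
Context {R : realType} {n m p : nat}.
Variables (g : 'rV[R]_m -> R) (F : 'rV[R]_n -> 'rV[R]_m) (h : 'rV[R]_n -> \bar R).
Variables (Lp : 'rV[R]_m) (Lg fstar M : R).
Hypothesis A : assumptionA p g F h Lp Lg fstar.
Local Notation f := (composite g F h).
Local Notation N := (p.+1`!%:R : R).
Local Notation K := (Lg * enorm Lp).

Lemma composite_fin_num z : dome f z -> h z \is a fin_num.
Proof.
have [_ _ _ _ [hNy _] _ _ _ _] := A; move: (hNy z).
by rewrite /dome/= /composite; case: (h z).
Qed.

Lemma fstar_le z : dome f z -> fstar <= fine (f z).
Proof.
move=> fz; rewrite -lee_fin fineK; last first.
  by rewrite /composite fin_numD /= composite_fin_num.
by apply: le_trans (A_lower_bound A) _; apply: ereal_inf_lbound; exists z.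
Qed.

Lemma model_error (x z : 'rV[R]_n) :
  `|g (F z) - g (taylor_map p F z x)| <= K / N * enorm (z - x) ^+ p.+1.
Proof. by case: A => dF lF _ lg *; exact: lipschitz_taylor_map. Qed.

Lemma reg_model_self x : reg_model p g F h M x x = f x.
Proof.
rewrite /reg_model /composite subrr enorm0 expr0n mulr0 addr0.
congr ((g _)%:E + _)%E; apply/rowP => i; rewrite mxE taylor_xx//.
exact: (A_differentiable A).
Qed.

Lemma rhota_descent x x' : dome f x -> dome f x' ->
  (reg_model p g F h M x' x <= reg_model p g F h M x x)%E ->
  (M - K) / N * enorm (x' - x) ^+ p.+1 <= fine (f x) - fine (f x').
Proof.
move=> /composite_fin_num hx /composite_fin_num hx'.
have := model_error x x'; rewrite ler_norml => /andP[_ err].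
rewrite reg_model_self /reg_model /composite.
move: (h x) (h x') hx hx' => [a| |]// [b| |]// _ _; rewrite -!EFinD lee_fin /=.
by lra.
Qed.

Context {mu delta : R} {x x' y : 'rV[R]_n}.
Hypothesis M_gt0 : 0 < M.
Hypothesis mu_gt : M + K < mu.
Hypothesis fx : dome f x.
Hypothesis y_min : minimizer (fun z => (f z + (mu / N * enorm (z - x) ^+ p.+1)%R%:E)%E) y.

Let mu_gt0 : 0 < mu.
Proof.
exact: lt_trans (ltr_pwDl M_gt0 (elipschitz_const_ge0 Lp (A_g_lipschitz A))) mu_gt. Qed.

Lemma proximal_dome : dome f y.
Proof.
have := y_min x; rewrite subrr enorm0 expr0n mulr0 adde0 => /le_lt_trans/(_ fx).
by rewrite /dome /=; case: (f y) => [r _| |]; rewrite ?ltry.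
Qed.

(** Testing the minimality of [y] against [x] and using f(y) >= f* gives mu / N |y - x|^(p+1) <=
    f(x) - f*; then take the (p+1)-th root. This makes [y] a competitor in the inexact optimality
    condition. *)
Lemma proximal_le_radius : enorm (y - x) <= model_radius p f fstar mu x.
Proof.
have fy := fstar_le proximal_dome.
have := y_min x; rewrite subrr enorm0 expr0n mulr0 adde0.
have := composite_fin_num fx; have := composite_fin_num proximal_dome.
rewrite /model_radius; move: fy; rewrite /composite.
move: (h x) (h y) => [a| |]// [b| |]//; rewrite -!EFinD /= lee_fin => fy _ _ H.
have N0 : 0 < N by rewrite ltr0n fact_gt0.
set e := enorm (y - x) in H *.
have e0 : 0 <= e by exact: enorm_ge0.
have muN : 0 < mu / N by rewrite divr_gt0.
have bound : e ^+ p.+1 <= N / mu * (g (F x) + a - fstar).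
  by rewrite -ler_pdivrMl ?divr_gt0// invf_div; lra.
have -> : e = (e ^+ p.+1) `^ (p.+1%:R^-1).
  by rewrite -powR_mulrn// -powRrM mulfV// powRr1.
apply: ge0_ler_powR => //; rewrite ?nnegrE ?exprn_ge0//.
exact: le_trans (exprn_ge0 _ e0) bound.
Qed.

(** With X = |x' - x|^(p+1) and Y = |y - x|^(p+1), the model bounds give f(x') + (M - K) / N X <=
    f(y) + (M + K) / N Y + delta / N X, while minimality gives f(y) + mu / N Y <= f(x') + mu / N X.
    Adding them eliminates both values of f. *)
Lemma proximal_le_step : dome f x' ->
  inexact_opt p g F h M delta (model_radius p f fstar mu x) x' x ->
  enorm (y - x) ^+ p.+1 <= (mu + delta + K - M) / (mu - (M + K)) * enorm (x' - x) ^+ p.+1.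
Proof.
move=> fx' opt; set Y := _ ^+ _; set X := _ ^+ _.
have N0 : 0 < N by rewrite ltr0n fact_gt0.
have H : (reg_model p g F h M x' x <= reg_model p g F h M y x + (delta / N * X)%:E)%E.
  have : (ereal_inf [set reg_model p g F h M z x | z in
      [set z | (enorm (z - x) <= model_radius p f fstar mu x)%R]] <=
      reg_model p g F h M y x)%E.
    by apply: ereal_inf_lbound; exists y => //; exact: proximal_le_radius.
  move: opt; rewrite /inexact_opt -/X; set I := ereal_inf _.
  have := composite_fin_num fx'; have := composite_fin_num proximal_dome.
  rewrite /reg_model; move: (h x') (h y) => [a| |]// [b| |]// _ _.
  (* An infinite infimum is impossible: +oo would exceed the finite model value at [y], and -oo
     would make the left side of the inexactness condition +oo. *)
  by case: I => [i| |]//; rewrite -?EFinD ?lee_fin//; lra.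
have := y_min x'; move: H; rewrite /reg_model /composite -/X -/Y.
have := composite_fin_num fx'; have := composite_fin_num proximal_dome.
move: (h x') (h y) => [a| |]// [b| |]// _ _; rewrite -!EFinD !lee_fin => H1 H2.
have := model_error x x'; rewrite ler_norml -/X => /andP[_ H3].
have := model_error x y; rewrite ler_norml -/Y => /andP[H4 _].
(* Clearing the denominator of the ratio and dividing by N makes the goal a linear combination of
   the four inequalities. *)
rewrite mulrAC ler_pdivlMr ?subr_gt0// -(ler_pM2l (x := N^-1)) ?invr_gt0//.
lra.
Qed.

End rhota_step.

(** * From single steps to the averaged rate *)

Lemma poweR_stationarity_le (R : realType) (n p : nat) (f : 'rV[R]_n -> \bar R)
    (c e : R) (y : 'rV[R]_n) : (1 <= p)%N -> 0 <= c -> 0 <= e ->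
  (stationarity f y <= (c * e ^+ p)%:E)%E ->
  (stationarity f y `^ (p.+1%:R / p%:R) <= (c `^ (p.+1%:R / p%:R) * e ^+ p.+1)%:E)%E.
Proof.
move=> p1 c0 e0 Sle.
have p0 : p%:R != 0 :> R by rewrite pnatr_eq0 -lt0n.
(* Nonnegativity is what makes the power monotone here; the value may a priori be +oo, so the power
   is taken in the extended reals. *)
have S0 : (0 <= stationarity f y)%E.
  by apply: le_ereal_inf_tmp => _ [v _ <-]; rewrite lee_fin enorm_ge0.
have -> : c `^ (p.+1%:R / p%:R) * e ^+ p.+1 = (c * e ^+ p) `^ (p.+1%:R / p%:R).
  by rewrite powRM ?exprn_ge0// -(powR_mulrn p)// -powRrM mulrCA divff// mulr1 powR_mulrn.
rewrite -poweR_EFin; apply: gt0_ler_poweR => //; rewrite ?in_itv/= ?leey ?andbT//.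
by rewrite lee_fin mulr_ge0 ?exprn_ge0.
Qed.

Theorem theorem4p3 (R : realType) (n m p : nat)
  (g : 'rV[R]_m -> R) (F : 'rV[R]_n -> 'rV[R]_m) (h : 'rV[R]_n -> \bar R)
  (Lp : 'rV[R]_m) (Lg fstar M mu delta : R) (x y : nat -> 'rV[R]_n)
  (f := composite g F h)
  (Lmu := (mu + delta + Lg * enorm Lp - M) / (mu - (M + Lg * enorm Lp))) :
  (1 <= p)%N ->
  assumptionA p g F h Lp Lg fstar ->
  0 < M ->
  0 < M - Lg * enorm Lp ->
  rhota p g F h M x ->
  M + Lg * enorm Lp < mu ->
  0 <= delta ->
  (forall k, minimizer
     (fun z => (f z + (mu / (p.+1)`!%:R * enorm (z - x k) ^+ p.+1)%R%:E)%E)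
     (y k.+1)) ->
  (forall k,
     inexact_opt p g F h M delta (model_radius p f fstar mu (x k)) (x k.+1) (x k)) ->
  (forall k, enorm (y k.+1 - x k) ^+ p.+1
             <= Lmu * enorm (x k.+1 - x k) ^+ p.+1)
  /\
  (forall k,
     (\big[mine/+oo]_(j < k.+1)
        (stationarity f (y j.+1) `^ ((p.+1)%:R / p%:R))
      <= (Lmu * (fine (f (x 0%N)) - fstar) / k.+1%:R
          * (mu / p`!%:R) `^ ((p.+1)%:R / p%:R)
          * ((p.+1)`!%:R / (M - Lg * enorm Lp)))%R%:E)%E).
Proof.
move=> p1 A M0 MK rho muMK delta0 y_min opt.
have [xdom xdec] := rho.
have K0 := elipschitz_const_ge0 Lp (A_g_lipschitz A).
have step k : enorm (y k.+1 - x k) ^+ p.+1 <= Lmu * enorm (x k.+1 - x k) ^+ p.+1.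
  exact: (proximal_le_step A M0 muMK (xdom k) (y_min k) (xdom k.+1) (opt k)).
split=> // k.
have mu0 : 0 < mu by lra.
have Lmu0 : 0 <= Lmu by rewrite /Lmu divr_ge0//; lra.
have N0 : 0 < p.+1`!%:R :> R by rewrite ltr0n fact_gt0.
pose X j := enorm (x j.+1 - x j) ^+ p.+1.
have sumX : \sum_(j < k.+1) X j <=
    p.+1`!%:R / (M - Lg * enorm Lp) * (fine (f (x 0%N)) - fstar).
  rewrite -ler_pdivrMl ?divr_gt0// invf_div mulr_sumr.
  apply: (@le_trans _ _ (fine (f (x 0%N)) - fine (f (x k.+1)))).
    (* The per-step decreases f(x_j) - f(x_(j+1)) telescope, and f(x_(k+1)) is then bounded below by
       f*. *)
    rewrite -opprB -(telescope_sumr (fun j => fine (f (x j))))// -sumrN big_mkord.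
    by apply: ler_sum => j _; rewrite opprB; exact: (rhota_descent A).
  by rewrite lerB// (fstar_le A).
set c := (mu / p`!%:R) `^ _.
have c0 : 0 <= c by exact: powR_ge0.
(* Some index has its term below the mean of the summable majorants c Lmu X_j; the minimum is
   bounded by the stationarity term at that index. *)
have [] := @exists_le_mean R k (fun j => c * (Lmu * X j))
    (c * (Lmu * (p.+1`!%:R / (M - Lg * enorm Lp) * (fine (f (x 0%N)) - fstar)))).
  by rewrite -!mulr_sumr ler_wpM2l// ler_wpM2l.
move=> j jle; apply: (bigmin_inf j) => //.
have yfin : f (y j.+1) \is a fin_num.
  rewrite /f /composite fin_numD /=.
  exact: (composite_fin_num A (proximal_dome (xdom j) (y_min j))).
apply: (@le_trans _ _ (c * (Lmu * X j))%:E).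
  apply: (@le_trans _ _ (c * enorm (y j.+1 - x j) ^+ p.+1)%:E).
    apply: poweR_stationarity_le; rewrite ?divr_ge0 ?enorm_ge0 ?(ltW mu0)//.
    by apply: stationarity_proximal => //; exact: ltW.
  by rewrite lee_fin ler_wpM2l.
rewrite lee_fin; apply: (le_trans jle).
by rewrite le_eqVlt; apply/orP; left; apply/eqP; ring.
Qed.
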